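(* Let $g:\mathbb{R}^m\to\mathbb{R}$ be a (not necessarily convex) Fréchet differentiable function whose gradient is $L_g$-Lipschitz continuous ($L_g\ge 0$), and assume $g$ is bounded from below. Let $\alpha>0$, $\beta\in(0,1)$, $0<s<\frac{2(1-\beta)}{L_g}$, and let $(x_n)_{n\in\mathbb{N}}$, $(y_n)_{n\in\mathbb{N}}$ be the sequences generated from a starting point $x_0=y_0\in\mathbb{R}^m$ by $$x_{n+1}=y_n-s\nabla g(y_n)\ (n\ge 0),\qquad y_n=x_n+\frac{\beta n}{n+\alpha}(x_n-x_{n-1})\ (n\ge 1).$$ Assume that $(x_n)_{n\in\mathbb{N}}$ is bounded, let $\overline{x}\in\operatorname{crit}(g)$ be such that $\lim_{n\to+\infty}x_n=\overline{x}$, and suppose that $g$ fulfills the Łojasiewicz property at $\overline{x}$ with Łojasiewicz exponent $\theta=\frac12$. Then, for every $p>0$ there exist $a_1,a_2,a_3,a_4>0$ and $\overline{k}\in\mathbb{N}$ such that: (a$_1$) $g(y_n)-g(\overline{x})\le a_1\frac{1}{n^p}$ for every $n>\overline{k}$; (a$_2$) $g(x_n)-g(\overline{x})\le a_2\frac{1}{n^p}$ for every $n>\overline{k}$; (a$_3$) $\|x_n-\overline{x}\|\le a_3\frac{1}{n^{p/2}}$ for every $n>\overline{k}$; (a$_4$) $\|y_n-\overline{x}\|\le a_4\frac{1}{n^{p/2}}$ for every $n>\overline{k}$.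
   Context: $\|\cdot\|$ is the Euclidean norm; $\mathbb{N}=\{0,1,2,\dots\}$; $\operatorname{crit} f=\{x:\nabla f(x)=0\}$ for a differentiable function $f$. ''$L_g$-Lipschitz continuous gradient'' means $\|\nabla g(x)-\nabla g(y)\|\le L_g\|x-y\|$ for all $x,y$. The condition $0<s<\frac{2(1-\beta)}{L_g}$ is read as $s>0$ and $sL_g<2(1-\beta)$ (so when $L_g=0$ any $s>0$ is allowed). Łojasiewicz property: a differentiable function $f:\mathbb{R}^k\to\mathbb{R}$ fulfills the Łojasiewicz property at $\overline{z}\in\operatorname{crit} f$ with Łojasiewicz exponent $\theta\in(0,1)$ if there exist $K,\epsilon>0$ such that $|f(z)-f(\overline{z})|^\theta\le K\|\nabla f(z)\|$ for every $z$ with $\|z-\overline{z}\|<\epsilon$. *)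

(* Defs.v *)
From mathcomp Require Import all_boot all_order all_algebra.
From mathcomp Require Import all_classical all_reals all_analysis.

Set Implicit Arguments.
Unset Strict Implicit.
Unset Printing Implicit Defensive.

Import Order.TTheory GRing.Theory Num.Theory.
Import numFieldNormedType.Exports.

Local Open Scope classical_set_scope.
Local Open Scope ring_scope.

(* R^m is 'rV[R]_m.  The library norm `|u| on 'rV[R]_m is the sup norm, so the
   Euclidean norm is introduced separately.  The two norms are equivalent, hence
   the library's differentiability and convergence on 'rV[R]_m are the Euclidean
   ones. *)
Definition enorm (R : realType) (m : nat) (u : 'rV[R]_m) : R :=
  Num.sqrt (\sum_(i < m) u 0 i ^+ 2).

(* Coordinates of the Frechet derivative: 'd f x v = \sum_i grad f x 0 i * v 0 i
   wherever f is differentiable at x. *)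
Definition grad (R : realType) (m : nat) (f : 'rV[R]_m -> R) (x : 'rV[R]_m) :
    'rV[R]_m :=
  \row_(i < m) 'd f x (delta_mx 0 i).

Definition crit (R : realType) (m : nat) (f : 'rV[R]_m -> R) : set 'rV[R]_m :=
  [set x | grad f x = 0].

Definition lojasiewicz (R : realType) (m : nat) (f : 'rV[R]_m -> R)
    (zbar : 'rV[R]_m) (theta : R) : Prop :=
  [/\ crit f zbar, 0 < theta < 1 &
    exists K eps : R, [/\ 0 < K, 0 < eps &
      forall z : 'rV[R]_m, enorm (z - zbar) < eps ->
        `|f z - f zbar| `^ theta <= K * enorm (grad f z)]].

(* Main.v *)
(* With d_n = x_(n+1) - x_n, the descent lemma along y_n bounds the increment of
   s g(y_n) by a quadratic form in (d_n, d_(n+1)) whose coefficients converge.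
   The limit form is P0 |d|^2 + A0 <d, v> + Q0 |v|^2 with P0 + Q0 + |A0| < 0
   exactly because s L < 2 (1 - beta), so
     E_n = s (g(y_(n+1)) - g(xbar)) + (P0 - Q0) / 2 |d_n|^2
   eventually decreases by a multiple of |d_n|^2 + |d_(n+1)|^2.  As E_n -> 0 it is
   eventually nonnegative.  Since s grad g(y_(n+1)) = b_n d_n - d_(n+1), the
   Lojasiewicz inequality with exponent 1/2 bounds E_n by a multiple of the same
   quantity.  Hence |d_n|, and then |x_n - xbar| and |y_n - xbar|, decay
   geometrically, which beats every power of n; the function values follow from
   the descent lemma at the critical point xbar. *)
Require Import Defs.
From mathcomp Require Import all_boot all_order all_algebra.
From mathcomp Require Import all_classical all_reals all_analysis.
From mathcomp Require Import ring lra.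

Set Implicit Arguments.
Unset Strict Implicit.
Unset Printing Implicit Defensive.

Import Order.TTheory GRing.Theory Num.Theory.
Import numFieldNormedType.Exports.

Local Open Scope classical_set_scope.
Local Open Scope ring_scope.

(** * Euclidean inner product and norm on row vectors *)

Section Euclidean.
Context {R : realType} {m : nat}.
Implicit Types u v w : 'rV[R]_m.

Definition dot u v : R := \sum_(i < m) u 0 i * v 0 i.

Lemma dotC u v : dot u v = dot v u.
Proof. by apply: eq_bigr => i _; rewrite mulrC. Qed.

Lemma dotDl u v w : dot (u + v) w = dot u w + dot v w.
Proof. by rewrite -big_split; apply: eq_bigr => i _; rewrite !mxE mulrDl. Qed.

Lemma dotZl a u v : dot (a *: u) v = a * dot u v.
Proof. by rewrite mulr_sumr; apply: eq_bigr => i _; rewrite !mxE mulrA. Qed.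

Lemma dotNl u v : dot (- u) v = - dot u v.
Proof. by rewrite -scaleN1r dotZl mulN1r. Qed.

Lemma dotDr u v w : dot w (u + v) = dot w u + dot w v.
Proof. by rewrite !(dotC w) dotDl. Qed.

Lemma dotZr a u v : dot v (a *: u) = a * dot v u.
Proof. by rewrite !(dotC v) dotZl. Qed.

Lemma dotNr u v : dot v (- u) = - dot v u.
Proof. by rewrite !(dotC v) dotNl. Qed.

Definition dotE := (dotDl, dotDr, dotNl, dotNr, dotZl, dotZr).

Lemma dot_ge0 u : 0 <= dot u u.
Proof. by apply: sumr_ge0 => i _; rewrite -expr2 sqr_ge0. Qed.

Lemma enorm_ge0 u : 0 <= enorm u.
Proof. exact: sqrtr_ge0. Qed.

Lemma enorm_sqr u : enorm u ^+ 2 = dot u u.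
Proof.
rewrite sqr_sqrtr; last by apply: sumr_ge0 => i _; rewrite sqr_ge0.
by apply: eq_bigr => i _; rewrite expr2.
Qed.

Lemma enormN u : enorm (- u) = enorm u.
Proof.
by congr Num.sqrt; apply: eq_bigr => i _; rewrite mxE sqrrN.
Qed.

Lemma enormB u v : enorm (u - v) = enorm (v - u).
Proof. by rewrite -enormN opprB. Qed.

Lemma enormZ a u : enorm (a *: u) = `|a| * enorm u.
Proof.
apply/eqP; rewrite -(@eqrXn2 _ 2) ?mulr_ge0 ?enorm_ge0//.
by rewrite exprMn !enorm_sqr !dotE real_normK ?num_real// mulrA expr2.
Qed.

Lemma dot_le u v : dot u v <= enorm u * enorm v.
Proof.
have [v0|v0] := eqVneq (enorm v) 0.
  suff -> : dot u v = 0 by rewrite v0 mulr0.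
  have : dot v v = 0 by rewrite -enorm_sqr v0 expr0n.
  move=> /psumr_eq0P vi0; apply: big1 => i _.
  have /eqP := vi0 (fun j _ => sqr_ge0 (v 0 j)) i isT.
  by rewrite mulf_eq0 orbb => /eqP ->; rewrite mulr0.
have vp : 0 < enorm v by rewrite lt_neqAle eq_sym v0 enorm_ge0.
apply: le_trans (ler_norm _) _.
rewrite -(@ler_pXn2r _ 2)// ?nnegrE ?mulr_ge0 ?enorm_ge0// real_normK ?num_real//.
rewrite exprMn !enorm_sqr.
have vvp : 0 < dot v v by rewrite -enorm_sqr exprn_gt0.
(* This square expands to [dot v v] times the Cauchy-Schwarz defect
   [dot u u * dot v v - dot u v ^+ 2], so the positive factor can be cancelled. *)
have := dot_ge0 (dot v v *: u - dot u v *: v).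
rewrite !dotE (dotC v u) => h.
rewrite -subr_ge0 -(pmulr_rge0 _ vvp); lra.
Qed.

Lemma enormD u v : enorm (u + v) <= enorm u + enorm v.
Proof.
rewrite -(@ler_pXn2r _ 2)// ?nnegrE ?addr_ge0 ?enorm_ge0//.
rewrite sqrrD !enorm_sqr !dotE (dotC v u); have := dot_le u v; lra.
Qed.

Lemma dot2_le u v : 2 * `|dot u v| <= dot u u + dot v v.
Proof.
have := dot_ge0 (u + v); have := dot_ge0 (u - v).
rewrite !dotE (dotC v u); case: (ger0P (dot u v)) => _; lra.
Qed.

Lemma dotB_le u v : dot (u - v) (u - v) <= 2 * (dot u u + dot v v).
Proof. by have := dot_ge0 (u + v); rewrite !dotE; lra. Qed.

(** Library convergence is for the sup norm; it passes to each coordinate, and the Euclidean norm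
    depends continuously on finitely many coordinates. *)
Lemma cvg_enorm (x : nat -> 'rV[R]_m) (l : 'rV[R]_m) :
  x n @[n --> \oo] --> l -> enorm (x n - l) @[n --> \oo] --> 0.
Proof.
move=> xl; have -> : 0 = @enorm R m (l - l).
  by apply/esym/eqP; rewrite subrr -sqrf_eq0 enorm_sqr -(scale0r 0) dotZl mul0r.
have x0l i : x n 0 i - l 0 i @[n --> \oo] --> l 0 i - l 0 i.
  apply: cvgB; last exact: cvg_cst.
  exact: (continuous_cvg _ (@coord_continuous R 1 m 0 i l) xl).
apply: (continuous_cvg _ (@sqrt_continuous R _)).
apply: cvg_big => [|i _]; first exact: add_continuous.
have -> : (l - l) 0 i ^+ 2 = (l 0 i - l 0 i) ^+ 2 by rewrite !mxE.
under eq_fun do rewrite !mxE.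
exact: (continuous_cvg _ (@exprn_continuous R 2 _) (x0l i)).
Qed.

End Euclidean.

(** * Derivatives along a line and the descent lemma *)

Lemma diff_dot (R : realType) (m : nat) (g : 'rV[R]_m -> R) (u w : 'rV[R]_m) :
  differentiable g u -> 'd g u w = dot (grad g u) w.
Proof.
move=> dg; rewrite {1}(row_sum_delta w) linear_sum.
by apply: eq_bigr => i _; rewrite linearZ mxE mulrC.
Qed.

Lemma is_derive_line (R : realType) (m : nat) (g : 'rV[R]_m -> R)
    (u w : 'rV[R]_m) (t : R) : differentiable g (u + t *: w) ->
  is_derive t 1 (fun r => g (u + r *: w)) (dot (grad g (u + t *: w)) w).
Proof.
move=> dg; rewrite -diff_dot// -deriveE//.
have e : (fun h => h^-1 *: (((fun r => g (u + r *: w)) \o shift t) (h *: 1)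
              - g (u + t *: w))) =
         (fun h => h^-1 *: ((g \o shift (u + t *: w)) (h *: w) - g (u + t *: w))).
  apply/funext => h /=; congr (_ *: (g _ - _)).
  by rewrite scalerDl addrCA [h *: 1]mulr1.
split; last by rewrite /derive e.
by rewrite /derivable e; apply: diff_derivable.
Qed.

Lemma is_derive_quad (R : realType) (a b t : R) :
  is_derive t 1 (fun r : R => r * a + r ^+ 2 * b) (a + 2 * t * b).
Proof.
have di := @is_derive_id R R t 1.
have d := is_deriveD (is_deriveZ a di) (is_deriveZ b (is_deriveM di di)).
have -> : (fun r : R => r * a + r ^+ 2 * b) =
          (a \*: (@id R) + b \*: ((@id R) * (@id R)))%R.
  apply/funext => r; rewrite -[RHS]/(a * r + b * (r * r)); ring.
apply: is_derive_eq d _; rewrite -[LHS]/(a * 1 + b * (t * 1 + t * 1)); ring.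
Qed.

(** Instead of integrating the gradient along the segment, the quadratic bound is subtracted from
    [g] and the mean value theorem is applied on [0, 1] to the difference, whose derivative is
    nonpositive there by Cauchy-Schwarz and the Lipschitz bound. *)
Lemma descent (R : realType) (m : nat) (g : 'rV[R]_m -> R) (L : R)
    (u v : 'rV[R]_m) :
  (forall a, differentiable g a) ->
  (forall a b, enorm (grad g a - grad g b) <= L * enorm (a - b)) ->
  g v <= g u + dot (grad g u) (v - u) + L / 2 * dot (v - u) (v - u).
Proof.
move=> dg lip; set w := v - u.
pose f r := g (u + r *: w) - (r * dot (grad g u) w + r ^+ 2 * (L / 2 * dot w w)).
pose df r := dot (grad g (u + r *: w)) w -
  (dot (grad g u) w + (2 * r) * (L / 2 * dot w w)).
have fd (r : R) : is_derive r 1 f (df r).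
  have := @is_derive_line R m g u w r (dg _) => ?.
  exact: (is_deriveB (df := dot (grad g (u + r *: w)) w)
    (dg := dot (grad g u) w + (2 * r) * (L / 2 * dot w w)) _ (is_derive_quad _ _ _)).
have [c c01] := @MVT_segment R f df 0 1 ler01 (fun r _ => fd r)
  (derivable_within_continuous (fun r _ => @ex_derive _ _ _ _ _ _ _ (fd r))).
rewrite /f !scale0r !scale1r !addr0 /w subrKC -/w => e.
have c0 : 0 <= c by move: c01; rewrite in_itv /= => /andP[].
have : df c <= 0.
  rewrite /df opprD addrA -dotNl -dotDl.
  have := dot_le (grad g (u + c *: w) - grad g u) w.
  have := lip (u + c *: w) u.
  have -> : u + c *: w - u = c *: w by rewrite addrC addKr.
  rewrite enormZ ger0_norm//.
  move/(ler_wpM2r (enorm_ge0 w)); have := enorm_sqr w => <-; lra.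
lra.
Qed.

(** * Geometric decay of energies and of distances to a limit *)

Section RealSequences.
Context {R : realType}.

(** [E] is nonincreasing with limit 0, hence nonnegative. Inserting [E n / C <= D n] in the decrease
    contracts [E] by the factor [1 - eps / C], and [eps * D n <= E n - E n.+1 <= E n] transfers the
    decay to [D]. *)
Lemma geometric_energy (E D : nat -> R) (eps C : R) :
  0 < eps -> eps < C -> E n @[n --> \oo] --> 0 ->
  (forall n, 0 <= D n) ->
  (forall n, E n.+1 <= E n - eps * D n) -> (forall n, E n <= C * D n) ->
  exists q K : R, [/\ 0 < q < 1, 0 <= K & forall n, D n <= K * q ^+ n].
Proof.
move=> e0 eC E0 D0 dE ED.
have C0 : 0 < C by apply: lt_trans eC.
have Ege0 n : 0 <= E n.
  rewrite -(cvg_lim _ E0)//; apply: nonincreasing_cvgn_ge; last exact: cvgP E0.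
  apply/nonincreasing_seqP => k; apply: le_trans (dE k) _.
  by rewrite lerBlDr lerDl mulr_ge0// ltW.
exists (1 - eps / C), (E 0%N / eps); split.
- by rewrite subr_gt0 ltrBlDr ltrDl ltr_pdivrMr// mul1r eC divr_gt0.
- by rewrite divr_ge0// ltW.
have Eq n : E n <= E 0%N * (1 - eps / C) ^+ n.
  elim: n => [|n ih]; first by rewrite expr0 mulr1.
  rewrite exprSr mulrA; apply: le_trans (dE n) _.
  apply: (@le_trans _ _ (E n * (1 - eps / C))).
    rewrite mulrBr mulr1 lerD2l lerN2 mulrCA ler_pM2l//.
    by rewrite ler_pdivrMr// mulrC.
  by rewrite ler_wpM2r// subr_ge0 ler_pdivrMr// mul1r ltW.
move=> n; rewrite mulrAC ler_pdivlMr// mulrC; apply: le_trans (Eq n).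
by have := dE n; have := Ege0 n.+1; lra.
Qed.

(** With [c = - ln r], the inequality 1 + t <= exp t at t = nc/p gives n <= (p/c) exp(nc/p); the
    power [p] of this is the claim. *)
Lemma powR_geometric (p r : R) : 0 < p -> 0 < r < 1 ->
  exists2 A : R, 0 < A & forall n, n%:R `^ p * r ^+ n <= A.
Proof.
move=> p0 /andP[r0 r1]; set c := - ln r.
have c0 : 0 < c by rewrite oppr_gt0 ln_lt0// r0 r1.
exists ((p / c) `^ p) => [|n]; first by rewrite powR_gt0 ?divr_gt0.
have -> : r ^+ n = expR (- (n%:R * c)).
  by rewrite mulrN opprK expRM_natl lnK.
rewrite expRN ler_pdivrMr ?expR_gt0//.
have -> : n%:R * c = (n%:R * c / p) * p by rewrite divfK ?gt_eqF.
rewrite expRM -powRM ?divr_ge0 ?expR_ge0 ?(ltW p0) ?(ltW c0)//.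
apply: (ge0_ler_powR (ltW p0)); rewrite ?nnegrE ?mulr_ge0 ?invr_ge0 ?expR_ge0 ?(ltW p0) ?(ltW c0)//.
have {1}-> : n%:R = p / c * (n%:R * c / p) :> R by field; rewrite !gt_eqF.
rewrite ler_pM2l ?divr_gt0//; apply: le_trans (expR_ge1Dx _).
by rewrite lerDr.
Qed.

End RealSequences.

(** No series is summed: [t n], the distance minus the claimed bound, is nondecreasing by the
    triangle inequality and tends to 0, so it is never positive. *)
Lemma geometric_steps (R : realType) (m : nat) (x : nat -> 'rV[R]_m)
    (l : 'rV[R]_m) (C r : R) : 0 < r < 1 ->
  x n @[n --> \oo] --> l ->
  (forall n, enorm (x n.+1 - x n) <= C * r ^+ n) ->
  forall n, enorm (x n - l) <= C / (1 - r) * r ^+ n.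
Proof.
move=> /andP[r0 r1] xl dx.
pose t n := enorm (x n - l) - C / (1 - r) * r ^+ n.
have t0 : t n @[n --> \oo] --> (0 : R).
  rewrite -[X in _ --> X](subr0 0) -[X in _ --> _ - X](mulr0 (C / (1 - r))).
  apply: cvgB; first exact: cvg_enorm.
  by apply: cvgMl_tmp; apply: cvg_expr; rewrite gtr0_norm.
move=> n; rewrite -subr_le0 -/(t n) -(cvg_lim _ t0)//.
apply: nondecreasing_cvgn_le; last exact: cvgP t0.
apply/nondecreasing_seqP => k; rewrite /t exprS.
have := enormD (x k - x k.+1) (x k.+1 - l).
rewrite addrA subrK enormB => h; have := dx k.
have -> : C * r ^+ k = C / (1 - r) * r ^+ k - C / (1 - r) * (r * r ^+ k).
  by field; rewrite subr_eq0 gt_eqF.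
lra.
Qed.

(** * The quadratic form in two consecutive steps *)

Section QuadraticForm.
Context {R : realType}.
Implicit Types b c la : R.

(** Coefficients of the form in [energy_form]: [la] stands for [s * L], and [b], [c] for consecutive
    inertia coefficients. *)
Definition coefP la b := b ^+ 2 * (la / 2 - 1).
Definition coefA la b c := b * (2 + c - la * (1 + c)).
Definition coefQ la c := la / 2 * (1 + c) ^+ 2 - (1 + c).

(* The two signs of coefA correspond to testing the form of energy_form on
   v = d and v = - d; the bound on la is sharp for v = d. *)
Lemma coef_limit_lt0 la b : 0 < b < 1 -> la < 2 * (1 - b) ->
  coefP la b + coefQ la b + `|coefA la b b| < 0.
Proof.
move=> /andP[b0 b1] lab.
have h1 : coefP la b + coefQ la b + coefA la b b < 0.
  rewrite /coefP /coefA /coefQ; lra.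
have h2 : coefP la b + coefQ la b - coefA la b b < 0.
  have -> : coefP la b + coefQ la b - coefA la b b =
    (1 + 2 * b) * (la / 2 * (1 + 2 * b) - (1 + b)).
    by rewrite /coefP /coefA /coefQ; field.
  rewrite pmulr_rlt0; last lra.
  (* Enough because (1 - b)(1 + 2b) = 1 + b - 2b^2 lies below 1 + b. *)
  have : (la / 2 - (1 - b)) * (1 + 2 * b) < 0 by rewrite pmulr_llt0; lra.
  have : 0 < b * b by rewrite mulr_gt0.
  lra.
by case: (ger0P (coefA la b b)) => _; lra.
Qed.

(** For consecutive steps [d] and [v], [w] is the increment of [y] and [b *: d - v] is [s] times the
    gradient, so the left side is [s] times the increment bound of the descent lemma. *)
Lemma energy_form (m : nat) la b c (d v : 'rV[R]_m) :
  let w := (1 + c) *: v - b *: d in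
  dot (b *: d - v) w + la / 2 * dot w w =
  coefP la b * dot d d + coefA la b c * dot d v + coefQ la c * dot v v.
Proof.
by rewrite /= !dotE (dotC v d) /coefP /coefA /coefQ; field.
Qed.

End QuadraticForm.

(** * Energy decrease and linear convergence of the iterates *)

Section Rate.
Context {R : realType} {m : nat}.
Context (g : 'rV[R]_m -> R) (L beta s : R) (b : nat -> R).
Context (x y : nat -> 'rV[R]_m) (xbar : 'rV[R]_m).
Context (g_diff : forall u, differentiable g u)
  (grad_lip : forall u v, enorm (grad g u - grad g v) <= L * enorm (u - v))
  (beta01 : 0 < beta < 1) (s_gt0 : 0 < s) (s_lt : s * L < 2 * (1 - beta))
  (b01 : forall n, 0 <= b n <= 1) (b_cvg : b n @[n --> \oo] --> beta)
  (x_rec : forall n, x n.+1 = y n - s *: grad g (y n))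
  (y_rec : forall n, y n.+1 = x n.+1 + b n *: (x n.+1 - x n))
  (x_cvg : x n @[n --> \oo] --> xbar)
  (g_loja : lojasiewicz g xbar (1 / 2)).

Let d n := x n.+1 - x n.
Let P0 := coefP (s * L) beta.
Let A0 := coefA (s * L) beta beta.
Let Q0 := coefQ (s * L) beta.
Let X n := dot (d n) (d n).
(** The weight of [X n] symmetrises the limit form: P0 X_n + Q0 X_(n+1) is (P0 + Q0)/2 times the sum
    X_n + X_(n+1), plus (P0 - Q0)/2 times X_n - X_(n+1), which telescopes into [E]. *)
Let E n := s * (g (y n.+1) - g xbar) + (P0 - Q0) / 2 * X n.
Let eps := - (P0 + Q0 + `|A0|) / 2.
(** Error from replacing the coefficients by their limits; the cross term is halved because 2|<d,
    v>| is at most |d|^2 + |v|^2. *)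
Let kappa n := `|coefP (s * L) (b n) - P0| +
  `|coefA (s * L) (b n) (b n.+1) - A0| / 2 + `|coefQ (s * L) (b n.+1) - Q0|.

Let eps_gt0 : 0 < eps.
Proof. by have := coef_limit_lt0 beta01 s_lt; rewrite /eps /P0 /Q0 /A0; lra. Qed.

Let grad_step n : s *: grad g (y n.+1) = b n *: d n - d n.+1.
Proof.
rewrite /d (x_rec n.+1) y_rec -/(d n).
by apply/rowP => i; rewrite !mxE; ring.
Qed.

Let y_step n : y n.+2 - y n.+1 = (1 + b n.+1) *: d n.+1 - b n *: d n.
Proof. by rewrite !y_rec /d; apply/rowP => i; rewrite !mxE; ring. Qed.

Let energy_step n : E n.+1 <= E n - (eps - kappa n) * (X n + X n.+1).
Proof.
have := descent (y n.+1) (y n.+2) g_diff grad_lip.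
rewrite -(ler_pM2l s_gt0) !mulrDr -(dotZl s) grad_step y_step !mulrA.
have := energy_form (s * L) (b n) (b n.+1) (d n) (d n.+1).
rewrite /= => ef; rewrite -addrA ef -/(X n) -/(X n.+1) => h.
have := dot2_le (d n) (d n.+1); rewrite -/(X n) -/(X n.+1).
set Z := dot (d n) (d n.+1) in h * => Zle.
have Xn := dot_ge0 (d n) : 0 <= X n.
have Xn1 := dot_ge0 (d n.+1) : 0 <= X n.+1.
have kP := ler_wpM2r Xn (ler_norm (coefP (s * L) (b n) - P0)).
have kQ := ler_wpM2r Xn1 (ler_norm (coefQ (s * L) (b n.+1) - Q0)).
have kA : (coefA (s * L) (b n) (b n.+1) - A0) * Z <=
    `|coefA (s * L) (b n) (b n.+1) - A0| / 2 * (X n + X n.+1).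
  apply: le_trans (ler_norm _) _; rewrite normrM -mulrA ler_wpM2l//; lra.
have kA0 : A0 * Z <= `|A0| / 2 * (X n + X n.+1).
  apply: le_trans (ler_norm _) _; rewrite normrM -mulrA ler_wpM2l//; lra.
(* These nonnegative terms let each diagonal error multiply the whole sum [X n + X n.+1]. *)
have kP' := mulr_ge0 (normr_ge0 (coefP (s * L) (b n) - P0)) Xn1.
have kQ' := mulr_ge0 (normr_ge0 (coefQ (s * L) (b n.+1) - Q0)) Xn.
rewrite /E /kappa /eps; lra.
Qed.

Let b_cvgS : b n.+1 @[n --> \oo] --> beta.
Proof. by rewrite cvg_shiftS. Qed.

Let kappa_cvg : kappa n @[n --> \oo] --> 0.
Proof.
have cst0 (c : R) : c @[n --> \oo] --> c by exact: cvg_cst.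
have dist0 (f : nat -> R) (l : R) : f n @[n --> \oo] --> l ->
    `|f n - l| @[n --> \oo] --> (0 : R).
  move=> fl; rewrite -(normr0 R) -(subrr l); apply: cvg_norm.
  by apply: cvgB.
have -> : 0 = 0 + 0 / 2 + 0 :> R by rewrite mul0r !addr0.
apply: cvgD; [apply: cvgD|]; [|apply: cvgM => //|]; apply: dist0.
- by rewrite /P0 /coefP expr2; under eq_fun do rewrite expr2; do !apply: cvgM.
- by apply: cvgM => //; apply: cvgB; [apply: cvgD|apply: cvgM => //; apply: cvgD].
- rewrite /Q0 /coefQ expr2; under eq_fun do rewrite expr2.
  by apply: cvgB; [apply: cvgM => //; apply: cvgM|]; apply: cvgD.
Qed.

Let x_cvgS : x n.+1 @[n --> \oo] --> xbar.
Proof. by rewrite cvg_shiftS. Qed.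

Let d_cvg : d n @[n --> \oo] --> (0 : 'rV[R]_m).
Proof. by rewrite -(subrr xbar); apply: cvgB. Qed.

Let yS_cvg : y n.+1 @[n --> \oo] --> xbar.
Proof.
rewrite -[xbar]addr0 -(scaler0 _ beta); under eq_fun do rewrite y_rec.
by apply: cvgD => //; apply: cvgZ.
Qed.

Let E_cvg : E n @[n --> \oo] --> 0.
Proof.
have -> : 0 = s * (g xbar - g xbar) + (P0 - Q0) / 2 * (0 * 0) :> R.
  by rewrite subrr !mulr0 addr0.
apply: cvgD; apply: cvgM; try exact: cvg_cst.
  apply: cvgB; last exact: cvg_cst.
  exact: (continuous_cvg _ (differentiable_continuous (g_diff xbar)) yS_cvg).
rewrite /X; under eq_fun do rewrite -enorm_sqr -[d _]subr0 expr2.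
by apply: cvgM; apply: cvg_enorm.
Qed.

Let E_le : exists2 C, eps / 2 < C &
  \forall n \near \oo, E n <= C * (X n + X n.+1).
Proof.
have [_ _ [K [e [K0 e0 loja]]]] := g_loja.
(* The first term comes from the Lojasiewicz inequality, the second from the weight of [X n]; [eps]
   ensures [eps / 2 < C], so that the contraction factor is positive. *)
exists (2 * K ^+ 2 / s + `|(P0 - Q0) / 2| + eps).
  have : 0 <= 2 * K ^+ 2 / s by rewrite divr_ge0 ?mulr_ge0 ?sqr_ge0 ?ltW.
  have := normr_ge0 ((P0 - Q0) / 2); have := eps_gt0; lra.
apply: filterS (cvgr_lt _ (cvg_enorm yS_cvg) _ e0) => n /loja.
rewrite mul1r powR12_sqrt// => h.
have Xn := dot_ge0 (d n) : 0 <= X n.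
have Xn1 := dot_ge0 (d n.+1) : 0 <= X n.+1.
have {h}h : `|g (y n.+1) - g xbar| <= K ^+ 2 * enorm (grad g (y n.+1)) ^+ 2.
  rewrite -exprMn -[leLHS]sqr_sqrtr// ler_sqr// nnegrE ?sqrtr_ge0//.
  by rewrite mulr_ge0 ?enorm_ge0 ?ltW.
have G : s ^+ 2 * enorm (grad g (y n.+1)) ^+ 2 <= 2 * (X n + X n.+1).
  rewrite -exprMn -{1}(gtr0_norm s_gt0) -enormZ grad_step enorm_sqr.
  have := dotB_le (b n *: d n) (d n.+1).
  rewrite dotZl dotZr -/(X n) -/(X n.+1).
  have /andP[bn0 bn1] := b01 n.
  have : b n * (b n * X n) <= X n.
    by rewrite mulrA ler_piMl// mulr_ile1.
  lra.
have hs : s * (g (y n.+1) - g xbar) <= 2 * K ^+ 2 / s * (X n + X n.+1).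
  apply: (@le_trans _ _ (s * (K ^+ 2 * enorm (grad g (y n.+1)) ^+ 2))).
    by rewrite ler_wpM2l ?(ltW s_gt0)//; apply: le_trans (ler_norm _) h.
  have -> : s * (K ^+ 2 * enorm (grad g (y n.+1)) ^+ 2) =
    K ^+ 2 / s * (s ^+ 2 * enorm (grad g (y n.+1)) ^+ 2).
    by field; rewrite gt_eqF.
  have -> : 2 * K ^+ 2 / s * (X n + X n.+1) = K ^+ 2 / s * (2 * (X n + X n.+1)).
    by field; rewrite gt_eqF.
  by rewrite ler_wpM2l// divr_ge0 ?sqr_ge0 ?ltW.
have hX : (P0 - Q0) / 2 * X n <= `|(P0 - Q0) / 2| * (X n + X n.+1).
  apply: (le_trans (ler_wpM2r Xn (ler_norm _))); rewrite ler_wpM2l//; lra.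
have := mulr_ge0 (ltW eps_gt0) (addr_ge0 Xn Xn1).
rewrite /E; lra.
Qed.

Lemma linear_rate : exists (r K : R) (N : nat), [/\ 0 < r < 1, 0 <= K &
  forall n, (N <= n)%N -> enorm (x n - xbar) <= K * r ^+ n].
Proof.
have [C epsC EC] := E_le.
have eps2 : 0 < eps / 2 by rewrite divr_gt0.
have : \forall n \near \oo, kappa n <= eps / 2 /\ E n <= C * (X n + X n.+1).
  apply: filterI => //; apply: filterS (cvgr_lt _ kappa_cvg _ eps2).
  by move=> n /ltW.
move=> [N _ HN].
have Xge0 n : 0 <= X n := dot_ge0 (d n).
(* The sequences start at [N], beyond which [kappa n <= eps / 2] leaves a decrease rate of at least
   [eps / 2]. *)
have [||||||q [K [q01 K0 hK]]] := @geometric_energy R (fun k => E (k + N)%N)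
  (fun k => X (k + N)%N + X (k + N).+1) (eps / 2) C.
- by rewrite divr_gt0.
- exact: epsC.
- by rewrite (cvg_shiftn N E).
- by move=> n; rewrite addr_ge0.
- move=> n; have [kn _] := HN (n + N)%N (leq_addl _ _).
  apply: le_trans (energy_step _) _.
  by rewrite lerD2l lerN2 ler_wpM2r ?addr_ge0//; lra.
- by move=> n; have [] := HN (n + N)%N (leq_addl _ _).
have /andP[q0 q1] := q01.
(* [q] controls squared step lengths, so the steps themselves decay at rate [Num.sqrt q]. *)
pose r := Num.sqrt q.
have r2 : r ^+ 2 = q by rewrite sqr_sqrtr ?ltW.
have r0 : 0 < r by rewrite sqrtr_gt0.
have r1 : r < 1 by rewrite -sqrtr1 ltr_sqrt.
have := @geometric_steps R m (fun k => x (k + N)%N) xbar (Num.sqrt K) r.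
rewrite r0 r1 (cvg_shiftn N x) => /(_ isT x_cvg) h.
(* Dividing by [r ^+ N] undoes the index shift. *)
exists r, (Num.sqrt K / (1 - r) / r ^+ N), N; split; first by rewrite r0.
  by rewrite !divr_ge0 ?sqrtr_ge0 ?exprn_ge0 ?subr_ge0 ?ltW.
move=> n Nn; rewrite -{1}(subnK Nn); apply: le_trans (h _ _) _ => [k|].
  rewrite addSn -/(d _) -(@ler_pXn2r _ 2)//.
  - rewrite enorm_sqr exprMn sqr_sqrtr// exprAC r2.
    by apply: le_trans (hK k); rewrite lerDl.
  - exact: enorm_ge0.
  - by rewrite nnegrE mulr_ge0 ?sqrtr_ge0 ?exprn_ge0 ?ltW.
have -> : r ^+ n = r ^+ N * r ^+ (n - N) by rewrite -exprD subnKC.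
by rewrite mulrA divfK// gt_eqF ?exprn_gt0.
Qed.

End Rate.

(** * Inertia coefficients, and polynomial rates from geometric ones *)

Lemma inertia_cvg (R : realType) (alpha beta : R) : 0 < alpha -> 0 < beta ->
  beta * n.+1%:R / (n.+1%:R + alpha) @[n --> \oo] --> beta.
Proof.
move=> a0 b0.
have h : beta - beta * alpha * @harmonic R n @[n --> \oo] --> beta.
  rewrite -[X in _ --> X]subr0 -(mulr0 (beta * alpha)).
  by apply: cvgB; [exact: cvg_cst|apply: cvgMl_tmp; exact: cvg_harmonic].
apply: (squeeze_cvgr _ h (cvg_cst beta)); apply: nearW => n.
have np : 0 < n.+1%:R :> R by rewrite ltr0n.
have nap : 0 < n.+1%:R + alpha by rewrite addr_gt0.
apply/andP; split; last first.
  by rewrite ler_pdivrMr// ler_wpM2l ?(ltW b0)// lerDl ltW.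
rewrite -subr_ge0 /harmonic /=; move: n.+1%:R np nap => t tp tap.
have -> : beta * t / (t + alpha) - (beta - beta * alpha * t^-1) =
    beta * alpha ^+ 2 / ((t + alpha) * t).
  by field; rewrite !gt_eqF.
by rewrite divr_ge0 ?mulr_ge0 ?sqr_ge0 ?ltW.
Qed.

Lemma inertia_bound (R : realType) (alpha beta : R) (n : nat) :
  0 < alpha -> 0 < beta < 1 ->
  0 <= beta * n.+1%:R / (n.+1%:R + alpha) <= 1.
Proof.
move=> a0 /andP[b0 b1].
have nap : 0 < n.+1%:R + alpha by rewrite addr_gt0.
rewrite divr_ge0 ?mulr_ge0 ?(ltW b0) ?(ltW nap)//= ler_pdivrMr// mul1r.
by apply: (@le_trans _ _ n.+1%:R); rewrite ?lerDl ?(ltW a0)// ler_piMl// ltW.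
Qed.

Lemma polynomial_rate (R : realType) (m : nat) (z : nat -> 'rV[R]_m)
    (l : 'rV[R]_m) (r K : R) (N : nat) : 0 < r < 1 -> 0 <= K ->
  (forall n, (N <= n)%N -> enorm (z n - l) <= K * r ^+ n) ->
  forall p, 0 < p -> exists2 a, 0 < a &
    forall n, (N < n)%N -> enorm (z n - l) <= a * (1 / n%:R `^ p).
Proof.
move=> r01 K0 hz p p0; have [A A0 hA] := powR_geometric p0 r01.
(* The [+ 1] keeps the constant positive when [K] is 0. *)
exists (K * A + 1) => [|n Nn]; first by rewrite ltr_wpDl// mulr_ge0// ltW.
apply: le_trans (hz n (ltnW Nn)) _.
have np : 0 < n%:R `^ p :> R by rewrite powR_gt0 // ltr0n; case: n Nn.
rewrite mul1r ler_pdivlMr// -mulrA (mulrC (r ^+ n)).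
have := ler_wpM2l K0 (hA n); lra.
Qed.

(** At a critical point the linear term of the descent lemma vanishes, so function values inherit
    the square of the distance rate. *)
Lemma descent_crit (R : realType) (m : nat) (g : 'rV[R]_m -> R) (L a t : R)
    (l z : 'rV[R]_m) :
  (forall u, differentiable g u) ->
  (forall u v, enorm (grad g u - grad g v) <= L * enorm (u - v)) ->
  0 <= L -> crit g l -> enorm (z - l) <= a * t ->
  g z - g l <= (L / 2 * a ^+ 2 + 1) * t ^+ 2.
Proof.
move=> dg lip L0 gl zl; have := descent l z dg lip.
rewrite gl -(scale0r 0) dotZl mul0r addr0 -enorm_sqr => h.
have : enorm (z - l) ^+ 2 <= (a * t) ^+ 2.
  by rewrite ler_sqr// nnegrE ?enorm_ge0//; apply: le_trans zl; exact: enorm_ge0.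
rewrite exprMn => /(ler_wpM2l (_ : 0 <= L / 2)); rewrite divr_ge0// => /(_ isT).
have := sqr_ge0 t; lra.
Qed.

Theorem corollary14 (R : realType) (m : nat) (g : 'rV[R]_m -> R)
    (Lg alpha beta s : R) (x y : nat -> 'rV[R]_m) (xbar : 'rV[R]_m)
    (g_diff : forall u : 'rV[R]_m, differentiable g u)
    (Lg_ge0 : 0 <= Lg)
    (grad_lip : forall u v : 'rV[R]_m,
      enorm (grad g u - grad g v) <= Lg * enorm (u - v))
    (g_bounded_below : exists M : R, forall u : 'rV[R]_m, M <= g u)
    (alpha_gt0 : 0 < alpha)
    (beta01 : 0 < beta < 1)
    (s_gt0 : 0 < s)
    (s_lt : s * Lg < 2 * (1 - beta))
    (xy0 : x 0%N = y 0%N)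
    (x_rec : forall n : nat, x n.+1 = y n - s *: grad g (y n))
    (y_rec : forall n : nat, (1 <= n)%N ->
      y n = x n + (beta * n%:R / (n%:R + alpha)) *: (x n - x n.-1))
    (x_bounded : exists M : R, forall n : nat, enorm (x n) <= M)
    (xbar_crit : crit g xbar)
    (x_cvg : x n @[n --> \oo] --> xbar)
    (g_loja : lojasiewicz g xbar (1 / 2)) :
  forall p : R, 0 < p ->
  exists (a1 a2 a3 a4 : R) (kbar : nat),
    [/\ 0 < a1, 0 < a2, 0 < a3 & 0 < a4] /\
    [/\ forall n : nat, (kbar < n)%N ->
          g (y n) - g xbar <= a1 * (1 / n%:R `^ p),
        forall n : nat, (kbar < n)%N ->
          g (x n) - g xbar <= a2 * (1 / n%:R `^ p),
        forall n : nat, (kbar < n)%N ->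
          enorm (x n - xbar) <= a3 * (1 / n%:R `^ (p / 2)) &
        forall n : nat, (kbar < n)%N ->
          enorm (y n - xbar) <= a4 * (1 / n%:R `^ (p / 2))].
Proof.
move=> p p0.
(* Shifted by one: [b n] is the coefficient of [y n.+1], since the inertial recursion starts at
   index 1. *)
pose b n := beta * n.+1%:R / (n.+1%:R + alpha).
have /andP[b0 b1] := beta01.
have yS n : y n.+1 = x n.+1 + b n *: (x n.+1 - x n) by rewrite y_rec.
have bb n : 0 <= b n <= 1 := inertia_bound n alpha_gt0 beta01.
have [r [K [N [r01 K0 hx]]]] := linear_rate g_diff grad_lip beta01 s_gt0 s_lt
  bb (inertia_cvg alpha_gt0 b0) x_rec yS x_cvg g_loja.
have /andP[r0 r1] := r01.
(* The distance of [y n.+1] is at most twice that of [x n.+1] plus that of [x n]; the older iterate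
   costs the factor [r^-1] and one more index in the threshold. *)
have hy n : (N.+1 <= n)%N -> enorm (y n - xbar) <= (2 + r^-1) * K * r ^+ n.
  case: n => // n Nn; have /andP[bn0 bn1] := bb n.
  have -> : y n.+1 - xbar = (x n.+1 - xbar) +
      b n *: ((x n.+1 - xbar) - (x n - xbar)).
    by rewrite yS; apply/rowP => i; rewrite !mxE; ring.
  apply: le_trans (enormD _ _) _; rewrite enormZ ger0_norm//.
  have := enormD (x n.+1 - xbar) (- (x n - xbar)); rewrite enormN => h.
  have := ler_piMl (enorm_ge0 (x n.+1 - xbar - (x n - xbar))) bn1.
  have := hx n Nn; have := hx n.+1 (leqW Nn).
  have -> : (2 + r^-1) * K * r ^+ n.+1 = 2 * (K * r ^+ n.+1) + K * r ^+ n.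
    by rewrite exprS; field; rewrite gt_eqF.
  lra.
have p2 : 0 < p / 2 by rewrite divr_gt0.
have [a3 a3p h3] := polynomial_rate r01 K0 hx p2.
have Ky : 0 <= (2 + r^-1) * K by rewrite mulr_ge0// addr_ge0// invr_ge0 ltW.
have [a4 a4p h4] := polynomial_rate r01 Ky hy p2.
have tE n : (1 / n%:R `^ (p / 2)) ^+ 2 = 1 / n%:R `^ p :> R.
  by rewrite !mul1r exprVn -powR_mulrn ?powR_ge0// -powRrM divfK.
have coef_gt0 a : 0 < Lg / 2 * a ^+ 2 + 1.
  by rewrite ltr_wpDl// mulr_ge0 ?sqr_ge0 ?divr_ge0.
exists (Lg / 2 * a4 ^+ 2 + 1), (Lg / 2 * a3 ^+ 2 + 1), a3, a4, N.+1.
split; first by split; rewrite ?coef_gt0.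
split=> n Nn; rewrite -?tE.
- exact: descent_crit (h4 n Nn).
- exact: descent_crit (h3 n (ltnW Nn)).
- exact: h3 (ltnW Nn).
- exact: h4.
Qed.
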